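(* For every $k\geq 0$, every partition $\lambda\vdash k$, and every $0\leq h\leq\ell(\lambda)$, we have $a_{\lambda,h}=f_{h}^{\lambda}$; that is, $a_{\lambda,h}$ equals the number of standard Young tableaux of shape $\lambda$ in which, for each $1\le i\le h$, the entry $i$ lies in row $i$ (necessarily at the beginning of that row).
   Context: A partition $\lambda=(\lambda_1,\ldots,\lambda_\ell)$ of $k$ is a non-increasing sequence of positive integers summing to $k$, with length $\ell(\lambda)=\ell$; its diagram has rows of lengths $\lambda_1,\dots,\lambda_\ell$ from top to bottom. A standard Young tableau of shape $\lambda$ fills the boxes bijectively with $1,\ldots,k$, increasing along rows and down columns; $f^{\nu}$ is the number of standard Young tableaux of shape $\nu$. For a standard tableau $T$, $R_T(m)$ is the row containing $m$; $\operatorname{SYT}_{h}(\lambda)$ is the set of standard Young tableaux $T$ of shape $\lambda$ with $R_T(i+1)>R_T(i)$ for all $1\le i<h$, and $f^\lambda_h=|\operatorname{SYT}_h(\lambda)|$. For $n-k\ge\lambda_1$, $(n-k,\lambda)=(n-k,\lambda_1,\ldots,\lambda_\ell)\vdash n$. There is a polynomial $p_\lambda\in\mathbb{Q}[x]$ of degree $k$ with $f^{(n-k,\lambda)}=p_\lambda(n)$ for all large $n$, and $a_{\lambda,h}\in\mathbb{Q}$ ($0\le h\le k$) are the unique numbers with $f^{(n-k,\lambda)}=\sum_{h=0}^{k}(-1)^{h}a_{\lambda,h}\binom{n}{k-h}$ for all sufficiently large integers $n$. *)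

(* Defs.v *)
From mathcomp Require Import all_boot all_order all_algebra.
Set Implicit Arguments.
Unset Strict Implicit.
Unset Printing Implicit Defensive.

Definition is_partition (k : nat) (la : seq nat) : bool :=
  [&& sorted geq la, 0 \notin la & sumn la == k].

(* Boxes are indexed from 0: [Tagged _ c] with tag [r] is the box in row [r.+1]
   and column [c.+1] of the diagram. *)
Definition box (la : seq nat) : finType :=
  {r : 'I_(size la) & 'I_(nth 0 la r)}.

Definition box_row (la : seq nat) (b : box la) : nat := tag b.
Definition box_col (la : seq nat) (b : box la) : nat := tagged b.

(* [T b : 'I_(sumn la)] encodes the entry [(T b).+1], so that the entries range
   over 1, ..., sumn la. *)
Definition filling (la : seq nat) : finType :=
  {ffun box la -> 'I_(sumn la)}.

Definition entry (la : seq nat) (T : filling la) (b : box la) : nat := (T b).+1.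

Definition bijective_filling (la : seq nat) (T : filling la) : bool :=
  injectiveb T && [forall m, m \in codom T].

Definition increasing_rows (la : seq nat) (T : filling la) : bool :=
  [forall b : box la, forall c : box la,
    (box_row b == box_row c) && (box_col b < box_col c) ==>
    (entry T b < entry T c)].

Definition increasing_columns (la : seq nat) (T : filling la) : bool :=
  [forall b : box la, forall c : box la,
    (box_col b == box_col c) && (box_row b < box_row c) ==>
    (entry T b < entry T c)].

Definition SYT (la : seq nat) : {set filling la} :=
  [set T | [&& bijective_filling T, increasing_rows T & increasing_columns T]].

Definition num_SYT (la : seq nat) : nat := #|SYT la|.

(* The 1-based row and column containing the entry [m]; the value 0 means that
   [m] does not occur in [T]. *)
Definition entry_row (la : seq nat) (T : filling la) (m : nat) : nat :=
  if [pick b | entry T b == m] is Some b then (box_row b).+1 else 0.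
Definition entry_col (la : seq nat) (T : filling la) (m : nat) : nat :=
  if [pick b | entry T b == m] is Some b then (box_col b).+1 else 0.

Definition SYT_desc (la : seq nat) (h : nat) : {set filling la} :=
  [set T in SYT la |
    [forall i : 'I_h, (0 < i) ==> (entry_row T i < entry_row T i.+1)]].

Definition num_SYT_desc (la : seq nat) (h : nat) : nat := #|SYT_desc la h|.

Definition SYT_diag (la : seq nat) (h : nat) : {set filling la} :=
  [set T in SYT la | [forall i : 'I_h.+1, (0 < i) ==> (entry_row T i == i)]].

(* For [la] a partition of [k] and [n - k >= la_1], the sequence [n - k :: la]
   is the partition (n - k, la) of [n]. *)
Definition binomial_expansion (k : nat) (la : seq nat)
    (a : {ffun 'I_k.+1 -> rat}) : Prop :=
  exists N : nat, forall n : nat, N <= n ->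
    ((num_SYT ((n - k)%N :: la))%:R =
       \sum_(h < k.+1) (-1) ^+ h * a h * 'C(n, (k - h)%N)%:R :> rat)%R.

(* Main.v *)
(* Reading off the row of each entry identifies the standard tableaux of shape
   [la] with the lattice words of content [la]; the tableaux counted by
   [SYT_diag la h] correspond to the words beginning with 0, 1, ..., h - 1, that
   is, to the standard tableaux of the skew shape [la / 1^h].  Removing the last
   letter gives a recursion which is also satisfied by Aitken's determinant
   (|la| - h)! det (1 / (la_i - i + c_j)!), where c_j runs through 0, ..., r
   without h.  For h = 0 and the shape (n - k, la), expanding this determinant
   along its first row produces the determinants of [la / 1^h] as minors:
   f^(n - k, la) = sum_h (-1)^h 'C(n, k - h) f^(la / 1^h). *)
Require Import Defs.
From mathcomp Require Import all_boot all_order all_algebra.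
From mathcomp Require Import perm zify ring.

Set Implicit Arguments.
Unset Strict Implicit.
Unset Printing Implicit Defensive.

(** * Lattice words of given content, listed by their last letter *)

Section LatticeWords.

Variable r : nat.

Definition decr_at (f : nat -> nat) (i j : nat) : nat := f j - (j == i).

Definition nonincreasing (f : nat -> nat) : Prop := forall i, f i.+1 <= f i.

Definition lattice_word (w : seq nat) : Prop :=
  forall m i, count_mem i.+1 (take m w) <= count_mem i (take m w).

(** The condition [f i.+1 < f i] says that row [i] of the shape [f] ends in a removable corner, the
    possible place of the largest entry. *)
Fixpoint words (n : nat) (f : nat -> nat) : seq (seq nat) :=
  if n is n'.+1 then
    [seq rcons w i | i <- [seq i <- iota 0 r | f i.+1 < f i],
                     w <- words n' (decr_at f i)]
  else if all (fun i => f i == 0) (iota 0 r) then [:: [::]] else [::].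

Lemma nonincreasing_decr f i :
  nonincreasing f -> f i.+1 < f i -> nonincreasing (decr_at f i).
Proof.
move=> mono_f fi j; rewrite /decr_at; have := mono_f j.
case: eqVneq => [->|_]; case: eqVneq => [E|_] //=; first lia.
- lia.
- by subst j; lia.
by lia.
Qed.

Lemma nonincreasing_le f i j : nonincreasing f -> i <= j -> f j <= f i.
Proof.
move=> mono_f /subnK <-; elim: (j - i) => [|d IH]; first by rewrite add0n.
exact: leq_trans (mono_f _) IH.
Qed.

Lemma decr_at_support f i :
  (forall j, r <= j -> f j = 0) -> forall j, r <= j -> decr_at f i j = 0.
Proof. by move=> f0 j rj; rewrite /decr_at f0. Qed.

Lemma words_uniq n f : uniq (words n f).
Proof.
elim: n f => [|n IH] f /=; first by case: ifP.
apply: allpairs_uniq_dep => //=; first by rewrite filter_uniq ?iota_uniq.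
move=> /= [i w] [j v] _ _ /= /rcons_inj [-> ->] //.
Qed.

(** Deleting the last letter [i] of a lattice word leaves a lattice word, whose content is again
    non-increasing; this forces [f i.+1 < f i]. Conversely, proper prefixes are controlled by the
    shorter word and the full word by monotonicity of [f]. *)
Lemma mem_words n f w :
  nonincreasing f -> (forall i, r <= i -> f i = 0) ->
  w \in words n f <->
  [/\ size w = n, forall i, count_mem i w = f i & lattice_word w].
Proof.
elim: n f w => [|n IH] f w mono_f f0 /=.
  split.
    case: ifP => // /allP all0; rewrite inE => /eqP ->; split=> // i.
    case: (ltnP i r) => [ir|/f0 -> //].
    by rewrite (eqP (all0 i _)) // mem_iota.
  case=> /size0nil -> cnt _; rewrite ifT //.
  by apply/allP => i _; rewrite -cnt.
split.
  case/allpairsPdep => i [v [Hi Hv ->]].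
  move: Hi; rewrite mem_filter mem_iota add0n /= => /andP[fi ir].
  have [sv cv lv] :=
    (IH _ _ (nonincreasing_decr mono_f fi) (decr_at_support i f0)).1 Hv.
  have cnt j : count_mem j (rcons v i) = f j.
    rewrite -cats1 count_cat cv /= /decr_at addn0 [i == j]eq_sym.
    by case: (eqVneq j i) => [->|_] /=; lia.
  split=> //; first by rewrite size_rcons sv.
  move=> m j; case: (leqP m n) => mn.
    by rewrite -cats1 takel_cat ?sv //; apply: lv.
  by rewrite take_oversize ?size_rcons ?sv // !cnt.
case; case/lastP: w => [|v i] //; rewrite size_rcons => -[sv] cnt lat.
have cv j : count_mem j v = decr_at f i j.
  rewrite /decr_at -cnt -cats1 count_cat /= addn0 [i == j]eq_sym; lia.
have fi : f i.+1 < f i.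
  have := lat n i; rewrite -cats1 takel_cat ?sv // take_oversize ?sv //.
  rewrite !cv /decr_at eqxx.
  have : 0 < f i by rewrite -cnt -cats1 count_cat /= eqxx; lia.
  by case: eqVneq => [E|_] /=; lia.
have ir : i < r by case: (ltnP i r) => // /f0 E; rewrite E in fi.
apply/allpairsPdep; exists i, v; split=> //.
  by rewrite mem_filter fi mem_iota.
apply/(IH _ _ (nonincreasing_decr mono_f fi) (decr_at_support i f0)); split=> // m j.
case: (leqP m n) => mn; last first.
  have := lat n j; rewrite -cats1 takel_cat ?sv // !take_oversize ?sv //.
  exact: ltnW.
by have := lat m j; rewrite -cats1 takel_cat ?sv.
Qed.

(** As [h <= n], the deleted last letter lies outside the prescribed prefix. *)
Lemma count_words_rec (h n : nat) f :
  nonincreasing f -> (forall i, r <= i -> f i = 0) -> h <= n ->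
  count (fun w => take h w == iota 0 h) (words n.+1 f) =
  \sum_(i < r | f i.+1 < f i)
     count (fun w => take h w == iota 0 h) (words n (decr_at f i)).
Proof.
move=> mono_f f0 hn /=; rewrite count_flatten -map_comp sumnE big_map big_filter.
rewrite -[r in iota 0 r]subn0 big_mkord; apply: eq_bigr => i /= fi.
rewrite count_map; apply: eq_in_count => w.
case/(mem_words n w (nonincreasing_decr mono_f fi) (decr_at_support i f0)) => sw _ _ /=.
by rewrite -cats1 takel_cat ?sw.
Qed.

(** The prefix is now the whole word, so the count is 0 or 1 according to whether [iota 0 n] has
    content [f]. The bound [maxn n r] covers both supports. *)
Lemma count_words_base n f :
  nonincreasing f -> (forall i, r <= i -> f i = 0) ->
  count (fun w => take n w == iota 0 n) (words n f) =
  all (fun i => f i == (i < n)) (iota 0 (maxn n r)).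
Proof.
move=> mono_f f0.
rewrite -[RHS](_ : nat_of_bool (iota 0 n \in words n f) = _); last first.
  congr (nat_of_bool _); apply/idP/allP => [/(mem_words _ _ mono_f f0) [_ cnt _] i _|cnt].
    by rewrite -cnt count_uniq_mem ?iota_uniq // mem_iota.
  apply/(mem_words _ _ mono_f f0); split=> [|i|m i]; first exact: size_iota.
    rewrite count_uniq_mem ?iota_uniq // mem_iota add0n /=.
    case: (ltnP i (maxn n r)) => im; first by rewrite (eqP (cnt i _)) // mem_iota.
    by rewrite f0; lia.
  by rewrite take_iota !count_uniq_mem ?iota_uniq // !mem_iota; lia.
rewrite -count_uniq_mem ?words_uniq //; apply: eq_in_count => w.
by case/(mem_words _ _ mono_f f0) => sw _ _; rewrite take_oversize ?sw.
Qed.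

End LatticeWords.

(** * Aitken's determinant and its recursion *)

Section Det.
Import Order.TTheory GRing.Theory Num.Theory.
Local Open Scope ring_scope.

(** The value 0 at negative integers is that of the reciprocal Gamma function; it makes 1/(z - 1)! =
    z/z! hold for every integer, including z = 0. *)
Definition invfact (z : int) : rat := if z is Posz n then (n`!%:R)^-1 else 0.

Lemma invfact_pred z : invfact (z - 1) = z%:~R * invfact z.
Proof.
case: z => [[|n]|n]; rewrite ?mulr0 ?mul0r //.
have -> : n.+1%:Z - 1 = n%:Z by lia.
rewrite /= factS natrM invfM mulrA divff ?mul1r //.
by rewrite pnatr_eq0.
Qed.

Lemma invfact_neg z : z < 0 -> invfact z = 0.
Proof. by case: z. Qed.

(* Aitken's matrix for the skew shape [a / 1^h]: column [h] is the omitted one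
   of the columns [0, ..., r]. *)
Definition aitken (r : nat) (h : 'I_r.+1) (a : nat -> int) : 'M[rat]_r :=
  \matrix_(i, j) invfact (a i - i.+1%:Z + (lift h j : nat)%:Z).

Lemma sum_lift (r : nat) (h : 'I_r.+1) (s : 'S_r) :
  \sum_(j < r) (lift h (s j) : nat)%:Z = \sum_(j < r) j.+1%:Z - (h : nat)%:Z.
Proof.
rewrite -(reindex_inj (@perm_inj _ s) (P := xpredT)
             (F := fun j => (lift h j : nat)%:Z)) /=.
have E : \sum_(j < r.+1) (j : nat)%:Z = \sum_(j < r) j.+1%:Z.
  by rewrite big_ord_recl /= add0r; apply: eq_bigr => j _; rewrite /bump leq0n.
rewrite -E (bigD1_ord h) //=; lia.
Qed.

(** In a Leibniz term, lowering [a i] multiplies the factor of row [i] by its argument. The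
    arguments of a term add up to the same number for every permutation, so it factors out. *)
Lemma sum_det_aitken_pred (r : nat) (h : 'I_r.+1) (a : nat -> int) :
  \sum_(i < r) \det (aitken h (fun j => a j - (j == i :> nat)%:Z)) =
  (\sum_(i < r) a i - (h : nat)%:Z)%:~R * \det (aitken h a).
Proof.
rewrite exchange_big /= mulr_sumr; apply: eq_bigr => s _.
rewrite -mulr_sumr mulrCA; congr (_ * _).
pose b (j : 'I_r) : int := a j - j.+1%:Z + (lift h (s j) : nat)%:Z.
have -> : \sum_(i < r) a i - (h : nat)%:Z = \sum_i b i.
  rewrite !big_split /= sumrN sum_lift; ring.
rewrite rmorph_sum mulr_suml; apply: eq_bigr => i _.
rewrite [RHS](_ : _ = (b i)%:~R * \prod_j invfact (b j)); last first.
  by congr (_ * _); apply: eq_bigr => j _; rewrite mxE.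
rewrite (bigD1 i) // [in RHS](bigD1 i) //= mulrA -invfact_pred; congr (_ * _).
  by rewrite mxE eqxx /b; congr invfact; lia.
apply: eq_bigr => j ji; rewrite mxE /b.
by rewrite (_ : (j == i :> nat) = false) ?subr0 //; apply/negbTE.
Qed.

(** Removing a box from a row without a corner makes rows [i] and [i.+1] of the matrix equal; if [i]
    is the last row, then [f i = 0] and all arguments in it become negative. *)
Lemma det_aitken_stuck (r : nat) (h : 'I_r.+1) (f : nat -> nat) (i : 'I_r) :
  f r = 0%N -> f i.+1 = f i ->
  \det (aitken h (fun j => (f j)%:Z - (j == i :> nat)%:Z)) = 0.
Proof.
move=> fr fi; case: (ltnP i.+1 r) => ir.
  apply: (@determinant_alternate _ _ _ i (Ordinal ir)) => [|j].
    by rewrite -val_eqE /= neq_ltn ltnSn.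
  by rewrite !mxE /= eqxx fi gtn_eqF //; congr invfact; lia.
rewrite (expand_det_row _ i) big1 // => j _; rewrite mxE eqxx invfact_neg ?mul0r //.
have Er : i.+1 = r by have := ltn_ord i; lia.
by have := ltn_ord (lift h j); rewrite -fi Er fr /=; lia.
Qed.

(* In a nonzero Leibniz term all the exponents vanish, because they are
   nonnegative and add up to [\sum_i f i - h = 0]. *)
Lemma det_aitken_base (r : nat) (h : 'I_r.+1) (f : nat -> nat) :
  nonincreasing f -> (forall i, (r <= i)%N -> f i = 0%N) ->
  \sum_(i < r) (f i)%:Z = (h : nat)%:Z ->
  \det (aitken h (fun i => (f i)%:Z)) =
    (all (fun i => f i == (i < h)%N) (iota 0 (maxn h r)))%:R.
Proof.
move=> mono_f f0 sum_f.
have hr : (h <= r)%N by rewrite -ltnS.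
have sum_nat : (\sum_(i < r) f i = h)%N.
  apply/eqP; rewrite -eqz_nat -sum_f -natz natr_sum.
  by apply/eqP/eq_bigr => i _; rewrite natz.
rewrite (maxn_idPr hr); case: allP => [fE|nfE].
  have {}fE (i : 'I_r) : f i = (i < h)%N by apply/eqP; apply: fE; rewrite mem_iota /=.
  (* For the column 1^h the matrix is upper triangular with all diagonal entries 1/0!. *)
  rewrite -det_tr det_trig.
    rewrite big1 // => i _; rewrite !mxE fE /= /bump.
    by case: ltnP => ih; rewrite (_ : _ + _ = 0) //; lia.
  apply/is_trig_mxP => j i ji; rewrite !mxE fE invfact_neg // /= /bump.
  by case: ltnP => ih; case: leqP; lia.
(* Otherwise the first [h] values of [f] are all positive, and the sum [h] forces [f] to be the
   column 1^h. *)
have [h0 fh0] : (0 < h)%N /\ f h.-1 = 0%N.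
  have [|hf] := boolP ((0 < h)%N && (f h.-1 == 0%N)).
    by case/andP => h0 /eqP.
  case: nfE => /=; move: hf; rewrite negb_and -leqNgt leqn0.
  move=> {}hf i; rewrite mem_iota add0n => /= ir.
  have fge (j : 'I_r) : ((j < h)%N <= f j)%N.
    case: ltnP => // jh; case/orP: hf => [/eqP h0|]; first by rewrite h0 in jh.
    by rewrite -lt0n => /leq_trans; apply; apply: nonincreasing_le => //; lia.
  have sum_lt : (\sum_(j < r) (j < h) = h)%N.
    rewrite -[RHS]card_ord -sum1_card (big_ord_widen r (fun=> 1%N) hr) [RHS]big_mkcond.
    by apply: eq_bigr => j _; case: ifP.
  have /leqifP := leqif_sum (P := xpredT) (fun j _ => leqif_geq (fge j)).
  rewrite sum_nat sum_lt ltnn; case: ifP => // /forallP /(_ (Ordinal ir)) /= fi _.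
  by rewrite eqn_leq fi (fge (Ordinal ir)).
apply: big1 => s _; apply/eqP; rewrite mulf_eq0; apply/orP; right.
pose b (j : 'I_r) : int := (f j)%:Z - j.+1%:Z + (lift h (s j) : nat)%:Z.
have [/forallP b_ge0|] := boolP [forall j, 0 <= b j]; last first.
  rewrite negb_forall => /existsP [j]; rewrite -ltNge => bj.
  by apply/prodf_eq0; exists j; rewrite // mxE invfact_neg.
have sum_b : \sum_j b j = 0 by rewrite !big_split /= sumrN sum_lift sum_f; ring.
(* In row [h.-1], where [f] vanishes, exponent 0 would require column [h], the omitted one. *)
have ph : (h.-1 < r)%N by lia.
have /eqP : b (Ordinal ph) = 0.
  apply/eqP; move: sum_b => /eqP; rewrite psumr_eq0 // => /allP.
  exact: (fun H => H _ (mem_index_enum _)).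
have := neq_lift h (s (Ordinal ph)); rewrite -val_eqE /b /= fh0; lia.
Qed.

(** Induction on the number [n] of letters after the prescribed prefix: the factor from
    [sum_det_aitken_pred] is then [n.+1], which matches the growth of the factorial. *)
Lemma count_words_det (r : nat) (h : 'I_r.+1) (n : nat) (f : nat -> nat) :
  nonincreasing f -> (forall i, (r <= i)%N -> f i = 0%N) ->
  (\sum_(i < r) f i)%N = (h + n)%N ->
  (count (fun w => take h w == iota 0 h) (words r (h + n) f))%:R =
    n`!%:R * \det (aitken h (fun i => (f i)%:Z)).
Proof.
elim: n f => [|n IH] f mono_f f0 sum_f.
  rewrite addn0 in sum_f *; rewrite count_words_base // det_aitken_base ?mul1r //.
  by rewrite -sum_f -natz natr_sum; apply: eq_bigr => i _; rewrite natz.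
rewrite addnS count_words_rec ?leq_addr // natr_sum.
have -> : n.+1`!%:R * \det (aitken h (fun i => (f i)%:Z)) =
    n`!%:R * \sum_(i < r) \det (aitken h (fun j => (f j)%:Z - (j == i :> nat)%:Z)).
  rewrite (sum_det_aitken_pred h (fun i => (f i)%:Z)) factS natrM mulrCA mulrA.
  congr (_ * _ * _).
  have -> : \sum_(i < r) (f i)%:Z = (\sum_(i < r) f i)%N%:Z.
    by rewrite -natz natr_sum; apply: eq_bigr => i _; rewrite natz.
  by rewrite sum_f addnS -addSn PoszD; have -> : (h.+1%:Z + n%:Z - h%:Z) = n.+1%:Z by lia.
(* Rows without a removable corner contribute zero determinants, which leaves the index set of
   [count_words_rec]. *)
rewrite mulr_sumr [RHS](bigID (fun i : 'I_r => (f i.+1 < f i)%N)) /=.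
rewrite [X in _ + X]big1 ?addr0 => [|i fi]; last first.
  rewrite det_aitken_stuck ?mulr0 //; first exact: f0.
  by apply/eqP; rewrite eqn_leq mono_f leqNgt.
apply: eq_bigr => i fi; rewrite IH; first last.
- apply/eqP; rewrite -eqSS -addnS -sum_f (bigD1 i) // [in X in _ == X](bigD1 i) //=.
  rewrite /decr_at eqxx -addSn (_ : (f i - 1).+1 = f i); last by rewrite /=; lia.
  apply/eqP; congr (_ + _)%N; apply: eq_bigr => j ji.
  by rewrite (_ : (j == i :> nat) = false) ?subn0 //; apply/negbTE.
- exact: decr_at_support.
- exact: nonincreasing_decr.
congr (_ * \det _); apply/matrixP => j l; rewrite !mxE /decr_at; congr (invfact (_ - _ + _)).
by case: eqVneq => [->|_] /=; lia.
Qed.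

End Det.

(** * Positions of a letter in a word: the future rows of a tableau *)

Definition positions (w : seq nat) (r : nat) : seq nat :=
  [seq m <- iota 0 (size w) | nth 0 w m == r].

Lemma sorted_positions w r : sorted ltn (positions w r).
Proof. exact: (sorted_filter ltn_trans _ (iota_ltn_sorted _ _)). Qed.

Lemma count_take_positions w r m :
  count_mem r (take m w) = count (gtn m) (positions w r).
Proof.
rewrite /positions count_filter; elim/last_ind: w => [|w i IH] //=.
rewrite size_rcons -addn1 iotaD count_cat /= add0n addn0.
have -> :
    count (predI (gtn m) (fun j => nth 0 (rcons w i) j == r)) (iota 0 (size w)) =
    count (predI (gtn m) (fun j => nth 0 w j == r)) (iota 0 (size w)).
  by apply: eq_in_count => j; rewrite mem_iota /= => jw; rewrite nth_rcons jw.
rewrite -IH nth_rcons ltnn eqxx /= -cats1.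
case: (ltnP (size w) m) => mw /=.
  by rewrite !take_oversize ?size_cat ?addn1 ?count_cat /= ?addn0 // ltnW.
by rewrite takel_cat // addn0.
Qed.

Lemma size_positions w r : size (positions w r) = count_mem r w.
Proof.
rewrite -{2}(take_size w) count_take_positions; apply/esym/eqP.
rewrite -all_count; apply/allP => m.
by rewrite mem_filter mem_iota => /andP[_].
Qed.

(** This translates between prefix counts and entries, hence between the lattice condition and
    increasing columns. *)
Lemma sorted_ltn_nth_count s m c :
  sorted ltn s -> c < size s -> (nth 0 s c < m) = (c < count (gtn m) s).
Proof.
elim: s c => [|a s IH] c //= srt; have [|am] := ltnP a m.
  by case: c => [|c] am cs //=; rewrite add1n ltnS -IH //; apply: path_sorted srt.
have /allP as_lt := order_path_min ltn_trans srt.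
rewrite add0n (_ : count _ s = 0).
  case: c => [|c] cs /=; first by rewrite ltnNge am.
  by apply/negbTE; rewrite -leqNgt (leq_trans am) // ltnW // as_lt // mem_nth.
apply/eqP; rewrite -leqn0 leqNgt -has_count; apply/hasPn => x /as_lt ax /=.
by rewrite -leqNgt (leq_trans am) // ltnW.
Qed.

(** The prefix ending at occurrence [c] of [r'] contains more than [c] letters [r'], hence more than
    [c] letters [r]. *)
Lemma positions_columns w r r' c :
  lattice_word w -> r < r' -> c < count_mem r' w ->
  nth 0 (positions w r) c < nth 0 (positions w r') c.
Proof.
move=> lat rr' cw; set x := nth 0 (positions w r') c.
have xr' : x \in positions w r' by rewrite mem_nth ?size_positions.
have mono_c m : nonincreasing (fun i => count_mem i (take m w)) by move=> i; apply: lat.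
have cwr : c < count_mem r w.
  by have := nonincreasing_le (mono_c (size w)) (ltnW rr'); rewrite take_size; lia.
have : nth 0 (positions w r) c < x.+1.
  rewrite sorted_ltn_nth_count ?sorted_positions ?size_positions //.
  rewrite -count_take_positions.
  apply: leq_trans (nonincreasing_le (mono_c x.+1) (ltnW rr')).
  rewrite count_take_positions -sorted_ltn_nth_count ?sorted_positions ?size_positions //.
(* Equality is impossible, since one position cannot carry both [r] and [r']. *)
rewrite ltnS leq_eqVlt => /predU1P [Ex|//].
have := mem_nth 0 (_ : c < size (positions w r)); rewrite size_positions Ex => /(_ cwr).
move: xr'; rewrite !mem_filter => /andP[/eqP -> _] /andP[/eqP E _].
by rewrite E ltnn in rr'.
Qed.

(** * Standard tableaux as lattice words *)

Section Tableaux.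

Variable la : seq nat.
Hypothesis la_sorted : sorted geq la.

Notation n := (sumn la).

Lemma nonincreasing_nth : nonincreasing (nth 0 la).
Proof.
move=> i; case: (ltnP i.+1 (size la)) => il; last by rewrite nth_default.
exact: (sortedP 0 la_sorted).
Qed.

Lemma box_inj (b c : box la) :
  box_row b = box_row c -> box_col b = box_col c -> b = c.
Proof.
case: b c => [r x] [s y]; rewrite /box_row /box_col /= => /val_inj Ers.
by case: s / Ers y => y /val_inj ->.
Qed.

Lemma box_col_lt (b : box la) : box_col b < nth 0 la (box_row b).
Proof. exact: ltn_ord. Qed.

Lemma box_exists r c :
  c < nth 0 la r -> exists b : box la, box_row b = r /\ box_col b = c.
Proof.
move=> cr; case: (ltnP r (size la)) => rl; last by rewrite nth_default in cr.
by exists (Tagged (fun r : 'I_(size la) => 'I_(nth 0 la r))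
                  (Ordinal cr : 'I_(nth 0 la (Ordinal rl)))).
Qed.

Lemma card_box : #|box la| = n.
Proof.
rewrite card_tagged !sumnE big_map big_enum /=.
rewrite (big_nth 0) big_mkord; apply: eq_bigr => i _; exact: card_ord.
Qed.

(** Boxes are dependent pairs; plain coordinates allow a row of a tableau to be written as a map
    over [iota]. *)
Lemma box_funE (g : box la -> nat) :
  exists t : nat -> nat -> nat, forall b, g b = t (box_row b) (box_col b).
Proof.
exists (fun r c =>
  if [pick b : box la | (box_row b == r) && (box_col b == c)] is Some b
  then g b else 0) => b.
case: pickP => [c /andP[/eqP Er /eqP Ec]|/(_ b)]; last by rewrite !eqxx.
by rewrite (box_inj Er Ec).
Qed.

Lemma SYTP (T : filling la) :
  reflect [/\ injective T,
    forall b c, box_row b = box_row c -> box_col b < box_col c -> T b < T c &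
    forall b c, box_col b = box_col c -> box_row b < box_row c -> T b < T c]
   (T \in SYT la).
Proof.
rewrite inE; apply: (iffP and3P).
  case=> /andP[/injectiveP injT _] /forallP rT /forallP cT; split=> // b c E lt.
    by have /forallP/(_ c)/implyP := rT b; rewrite E eqxx lt => /(_ isT).
  by have /forallP/(_ c)/implyP := cT b; rewrite E eqxx lt => /(_ isT).
case=> injT rT cT; split.
- apply/andP; split; first exact/injectiveP.
  apply/forallP => m; apply: (inj_card_onto injT); by rewrite card_box card_ord.
- apply/forallP => b; apply/forallP => c; apply/implyP => /andP[/eqP E lt].
  by rewrite /entry ltnS rT.
- apply/forallP => b; apply/forallP => c; apply/implyP => /andP[/eqP E lt].
  by rewrite /entry ltnS cT.
Qed.

Lemma SYT_onto (T : filling la) (m : nat) :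
  T \in SYT la -> m < n -> exists b, T b = m :> nat.
Proof.
rewrite inE => /and3P[/andP[_ /forallP sT] _ _] mn.
by have /codomP [b E] := sT (Ordinal mn); exists b; rewrite -E.
Qed.

Lemma entry_row_box (T : filling la) (b : box la) :
  injective T -> entry_row T (T b).+1 = (box_row b).+1.
Proof.
move=> injT; rewrite /entry_row; case: pickP => [c|/(_ b)]; last by rewrite /entry eqxx.
by rewrite /entry eqSS => /eqP/val_inj/injT ->.
Qed.

Lemma entry_col_box (T : filling la) (b : box la) :
  injective T -> entry_col T (T b).+1 = (box_col b).+1.
Proof.
move=> injT; rewrite /entry_col; case: pickP => [c|/(_ b)]; last by rewrite /entry eqxx.
by rewrite /entry eqSS => /eqP/val_inj/injT ->.
Qed.

Definition row_word (T : filling la) : seq nat :=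
  [seq (entry_row T m.+1).-1 | m <- iota 0 n].

Lemma size_row_word T : size (row_word T) = n.
Proof. by rewrite size_map size_iota. Qed.

Lemma nth_row_word (T : filling la) (b : box la) :
  injective T -> nth 0 (row_word T) (T b) = box_row b.
Proof.
by move=> injT; rewrite (nth_map 0) ?size_iota // nth_iota // entry_row_box.
Qed.

(** Both lists are strictly increasing and have the same members, namely the entries of row [r]
    counted from 0. *)
Lemma positions_row_word (T : filling la) (t : nat -> nat -> nat) r :
  T \in SYT la -> (forall b, T b = t (box_row b) (box_col b) :> nat) ->
  positions (row_word T) r = [seq t r c | c <- iota 0 (nth 0 la r)].
Proof.
move=> sT tE; have [injT rT _] := SYTP _ sT.
apply: (irr_sorted_eq ltn_trans ltnn); first exact: sorted_positions.
  apply: (homo_sorted_in _ (P := gtn (nth 0 la r)) _ (iota_ltn_sorted 0 _)); last first.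
    by apply/allP => c; rewrite mem_iota.
  move=> c d cr dr cd; have [b [br bc]] := box_exists cr.
  have [b' [br' bc']] := box_exists dr.
  by have := rT b b'; rewrite !tE br br' bc bc'; apply.
move=> m; rewrite mem_filter mem_iota size_row_word /=.
apply/andP/mapP => [[/eqP mr /(SYT_onto sT) [b bm]]|[c]].
  exists (box_col b).
    by rewrite mem_iota -mr -bm nth_row_word //= box_col_lt.
  by rewrite -mr -bm nth_row_word // -tE.
rewrite mem_iota => /box_exists [b [<- <-]] ->.
by rewrite -tE nth_row_word.
Qed.

Lemma count_row_word (T : filling la) r :
  T \in SYT la -> count_mem r (row_word T) = nth 0 la r.
Proof.
move=> sT; have [t tE] := box_funE (fun b => T b : nat).
by rewrite -size_positions (positions_row_word r sT tE) size_map size_iota.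
Qed.

(** If a prefix had only [c] letters [r] but more letters [r.+1], it would contain the entry of row
    [r.+1] in column [c], hence also the smaller one above it, an additional letter [r]. *)
Lemma lattice_row_word (T : filling la) : T \in SYT la -> lattice_word (row_word T).
Proof.
move=> sT m r; have [t tE] := box_funE (fun b => T b : nat).
rewrite leqNgt; apply/negP => lt_c; set c := count_mem r _ in lt_c.
have cr' : c < nth 0 la r.+1.
  apply: (leq_trans lt_c); rewrite -(count_row_word _ sT).
  by rewrite -{2}(cat_take_drop m (row_word T)) count_cat leq_addr.
have cr := leq_trans cr' (nonincreasing_nth r).
have size_pos s : size (positions (row_word T) s) = nth 0 la s.
  by rewrite size_positions count_row_word.
have : c < c; last by rewrite ltnn.
rewrite {2}/c count_take_positions -sorted_ltn_nth_count ?sorted_positions ?size_pos //.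
move: lt_c; rewrite count_take_positions.
rewrite -sorted_ltn_nth_count ?sorted_positions ?size_pos //; apply: ltn_trans.
rewrite !(positions_row_word _ sT tE) !(nth_map 0) ?size_iota // !nth_iota // add0n.
have [b [br bc]] := box_exists cr; have [b' [br' bc']] := box_exists cr'.
have [_ _ cT] := SYTP _ sT.
by have := cT b b'; rewrite !tE br br' bc bc'; apply.
Qed.

Lemma row_word_inj : {in SYT la &, injective row_word}.
Proof.
move=> T T' sT sT' E; apply/ffunP => b; apply: val_inj.
have [t tE] := box_funE (fun b => T b : nat).
have [t' tE'] := box_funE (fun b => T' b : nat).
have := positions_row_word (box_row b) sT tE.
rewrite E (positions_row_word _ sT' tE') => /(congr1 (fun s => nth 0 s (box_col b))).
have bc := box_col_lt b.
by rewrite !(nth_map 0) ?size_iota // !nth_iota // add0n -tE -tE'.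
Qed.

Lemma row_word_onto w :
  size w = n -> (forall i, count_mem i w = nth 0 la i) -> lattice_word w ->
  exists2 T, T \in SYT la & row_word T = w.
Proof.
move=> sw cnt lat.
(* The inverse map: the box in row [r] and column [c] receives the position of occurrence [c] of the
   letter [r]. *)
pose t (b : box la) := nth 0 (positions w (box_row b)) (box_col b).
have size_pos (b : box la) : box_col b < size (positions w (box_row b)).
  by rewrite size_positions cnt; apply: box_col_lt.
have tP b : (nth 0 w (t b) == box_row b) && (t b < n).
  have := mem_nth 0 (size_pos b).
  by rewrite mem_filter mem_iota sw.
have tn b : t b < n by case/andP: (tP b).
have tw b : nth 0 w (t b) = box_row b by apply/eqP; case/andP: (tP b).
pose T : filling la := [ffun b => Ordinal (tn b)].
have TE b : T b = t b :> nat by rewrite ffunE.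
have injT : injective T.
  move=> b c /(congr1 val); rewrite /= !TE => E.
  have Er : box_row b = box_row c by rewrite -!tw E.
  apply: box_inj => //; apply/eqP.
  rewrite -(nth_uniq 0 (size_pos b) _ (sorted_uniq ltn_trans ltnn (sorted_positions _ _))).
    by rewrite {2}Er; apply/eqP.
  by rewrite Er.
have sT : T \in SYT la.
  apply/SYTP; split=> // b c E lt; rewrite !TE /t.
    rewrite E; apply: (sorted_ltn_nth ltn_trans) => //; rewrite ?inE //.
    - exact: sorted_positions.
    - by rewrite -E.
  rewrite E; apply: positions_columns => //; by rewrite cnt; apply: box_col_lt.
exists T => //; apply: (@eq_from_nth _ 0); rewrite size_row_word // => m mn.
have [b <-] := SYT_onto sT mn; by rewrite nth_row_word // TE tw.
Qed.

Lemma card_SYT_diag h :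
  h <= n ->
  #|SYT_diag la h| =
  count (fun w => take h w == iota 0 h) (words (size la) n (nth 0 la)).
Proof.
move=> hn; have f0 i : size la <= i -> nth 0 la i = 0 by apply: nth_default.
have words_perm :
    perm_eq (words (size la) n (nth 0 la)) [seq row_word T | T in SYT la].
  apply: uniq_perm; first exact: words_uniq.
    by rewrite map_inj_in_uniq ?enum_uniq // => T T'; rewrite !mem_enum; apply: row_word_inj.
  move=> w; apply/idP/mapP.
    case/(mem_words n w nonincreasing_nth f0) => sw cnt lat.
    by have [T sT <-] := row_word_onto sw cnt lat; exists T; rewrite ?mem_enum.
  case=> T; rewrite mem_enum => sT ->; apply/(mem_words n _ nonincreasing_nth f0).
  split=> [|i|]; first exact: size_row_word.
    exact: count_row_word.
  exact: lattice_row_word.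
rewrite (seq.permP words_perm) count_map -size_filter cardE; apply/perm_size/uniq_perm.
- exact: enum_uniq.
- by rewrite filter_uniq ?enum_uniq.
move=> T; rewrite mem_enum [RHS]mem_filter mem_enum [in LHS]inE andbC.
case: (boolP (T \in SYT la)) => sT; rewrite ?andbF //= !andbT.
(* This excludes the default value 0 of [entry_row], so the [.-1] in [row_word] can be undone. *)
have row_gt0 m : m < n -> 0 < entry_row T m.+1.
  case/(SYT_onto sT) => b <-; have [injT _ _] := SYTP _ sT; by rewrite entry_row_box.
apply/forallP/eqP => [diag|diag i].
  apply: (@eq_from_nth _ 0); rewrite size_takel ?size_row_word // ?size_iota // => j jh.
  have jn := leq_trans jh hn.
  rewrite nth_take // (nth_map 0) ?size_iota // !nth_iota // add0n.
  have /implyP /(_ isT) /eqP /= := diag (Ordinal (jh : j.+1 < h.+1)).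
  by move=> ->.
apply/implyP => i0; case: i i0 => [[|j] jh] //= _.
have jn := leq_trans (jh : j < h) hn.
have := congr1 (fun s => nth 0 s j) diag.
rewrite nth_take // (nth_map 0) ?size_iota // !nth_iota // add0n => E.
by rewrite -(prednK (row_gt0 _ jn)) E.
Qed.

(** Strictly increasing rows put entry [i.+1] in row [i.+1] or lower. If it were lower, the box
    above it in row [i.+1] would hold a smaller entry, which by induction lies in a higher row. *)
Lemma SYT_descE h : h <= n -> SYT_desc la h = SYT_diag la h.
Proof.
move=> hn; apply/setP => T; rewrite !inE; case sT : (T \in SYT la); last first.
  by rewrite inE in sT; rewrite sT.
have := sT; rewrite inE => -> /=; have [injT _ cT] := SYTP _ sT.
apply/forallP/forallP => [desc|diag i]; last first.
  apply/implyP => i0; have ih := ltn_ord i.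
  have /implyP /(_ i0) /eqP -> := diag (Ordinal (leqW ih : i < h.+1)).
  by have /implyP /(_ isT) /eqP /= -> := diag (Ordinal (ih : i.+1 < h.+1)).
suff rows i : i < h -> entry_row T i.+1 = i.+1.
  by case=> [[|i] ih] //; apply/implyP => _ /=; rewrite rows.
elim/ltn_ind: i => i IH ih.
have [b bi] := SYT_onto sT (leq_trans ih hn).
rewrite -bi entry_row_box // bi; congr _.+1.
have ige : i <= box_row b.
  case: i IH ih bi => [|i] IH ih bi //.
  have /implyP /(_ isT) /= := desc (Ordinal ih).
  by rewrite (IH i) ?(ltnW ih) // -[X in _ < entry_row T X.+1]bi entry_row_box.
apply/eqP; rewrite eqn_leq ige andbT leqNgt; apply/negP => lt.
have [c [cr cc]] : exists c : box la, box_row c = i /\ box_col c = box_col b.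
  apply: box_exists; apply: leq_trans (box_col_lt b) _.
  exact: nonincreasing_le nonincreasing_nth ige.
have Tc : T c < i by rewrite -bi; apply: cT; rewrite ?cr.
have := IH _ Tc (ltn_trans Tc ih); rewrite entry_row_box // cr => -[E].
by rewrite E ltnn in Tc.
Qed.

(** Otherwise the first box of that row would hold a smaller entry, but smaller entries lie in rows
    above. *)
Lemma SYT_diag_col h (T : filling la) :
  h <= n -> T \in SYT_diag la h -> forall i, 0 < i <= h -> entry_col T i = 1.
Proof.
move=> hn; rewrite inE => /andP[sT /forallP diag] [|i] // /andP[_ ih].
have rows j : j < h -> entry_row T j.+1 = j.+1.
  by move=> jh; have /implyP /(_ isT) /eqP := diag (Ordinal (jh : j.+1 < h.+1)).
have [injT rT _] := SYTP _ sT.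
have [b bi] := SYT_onto sT (leq_trans ih hn).
rewrite -bi entry_col_box //; congr _.+1; apply/eqP; rewrite -leqn0 leqNgt; apply/negP => c0.
have [c [cr cc]] := box_exists (leq_ltn_trans (leq0n _) (box_col_lt b)).
have Tc : T c < i by rewrite -bi; apply: rT => //; rewrite cc.
have := rows _ ih; rewrite -bi entry_row_box // bi -cr => -[E].
have := rows _ (ltn_trans Tc ih); rewrite entry_row_box // => -[E'].
by rewrite -E' E ltnn in Tc.
Qed.

End Tableaux.

(** * The binomial expansion and its uniqueness *)

Section Expansion.
Import Order.TTheory GRing.Theory Num.Theory.
Local Open Scope ring_scope.

Lemma card_SYT_diag_det (la : seq nat) (h : 'I_(size la).+1) :
  sorted geq la -> (h <= sumn la)%N ->
  #|SYT_diag la h|%:R =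
    (sumn la - h)`!%:R * \det (aitken h (fun i => (nth 0%N la i)%:Z)) :> rat.
Proof.
move=> srt hn; rewrite card_SYT_diag // -[in words _ _](subnKC hn).
apply: count_words_det; first exact: nonincreasing_nth.
  by move=> i; apply: nth_default.
by rewrite subnKC // sumnE (big_nth 0%N) big_mkord.
Qed.

Lemma SYT_diag0 la : SYT_diag la 0 = SYT la.
Proof.
apply/setP => T; rewrite inE; apply: andb_idr => _.
by apply/forallP => -[[|i] //].
Qed.

(* Laplace expansion of Aitken's determinant along the row of the new part [m]. *)
Lemma num_SYT_cons (la : seq nat) (m : nat) :
  sorted geq (m :: la) -> (size la <= sumn la)%N ->
  (num_SYT (m :: la))%:R =
    \sum_(h < (size la).+1)
       (-1) ^+ h * #|SYT_diag la h|%:R * 'C(m + sumn la, sumn la - h)%:R :> rat.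
Proof.
move=> srt le_size; have srt' : sorted geq la by apply: path_sorted srt.
rewrite /num_SYT -SYT_diag0 (card_SYT_diag_det (h := ord0)) // subn0.
rewrite (expand_det_row _ ord0) mulr_sumr; apply: eq_bigr => h _.
have hn : (h <= sumn la)%N by rewrite (leq_trans _ le_size) // -ltnS.
rewrite card_SYT_diag_det // /cofactor mxE add0n.
(* In the minor, row indices and column labels both shift by one, and the shifts cancel. *)
set M := row' _ _; have -> : M = aitken h (fun i => (nth 0%N la i)%:Z).
  by apply/matrixP => i j; rewrite !mxE !lift0 /=; congr invfact; lia.
(* The first-row entry is 1/(m + h)!; with the prefactor (m + |la|)! it yields the binomial
   coefficient times (|la| - h)!. *)
rewrite /= (_ : m%:Z - 1 + (bump 0 h)%:Z = (m + h)%N%:Z); last by rewrite /bump; lia.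
rewrite /= -(bin_fact (_ : sumn la - h <= m + sumn la)%N); last by lia.
rewrite (_ : m + sumn la - (sumn la - h) = m + h)%N; last by lia.
rewrite !natrM; field.
by rewrite pnatr_eq0 -lt0n fact_gt0.
Qed.

(** The forward difference in [n] turns 'C(n, j + 1) into 'C(n, j) and kills the constant term, so
    induction on [d] leaves only [c 0]. *)
Lemma binomial_sums_free (d N : nat) (c : nat -> rat) :
  (forall n, (N <= n)%N -> \sum_(j < d) c j * 'C(n, j)%:R = 0) ->
  forall j, (j < d)%N -> c j = 0.
Proof.
elim: d c => [|d IH] c // c0.
have c_pos j : (j < d)%N -> c j.+1 = 0.
  apply: (IH (fun j => c j.+1)) => n Nn.
  have := c0 n.+1 (leqW Nn); rewrite big_ord_recl -[X in _ = X](c0 n Nn) big_ord_recl !bin0.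
  move/addrI => /eqP; rewrite -subr_eq0 -sumrB => /eqP E.
  rewrite -[RHS]E; apply: eq_bigr => i _; rewrite /= /bump leq0n add1n binS natrD; ring.
case=> [_|j]; last exact: c_pos.
have := c0 N (leqnn N); rewrite big_ord_recl bin0 mulr1 big1 ?addr0 // => j _.
by rewrite /= /bump leq0n c_pos ?mul0r.
Qed.

Lemma binomial_expansion_inj k la (a b : {ffun 'I_k.+1 -> rat}) :
  binomial_expansion la a -> binomial_expansion la b -> a = b.
Proof.
case=> [N aE] [M bE].
(* The coefficient of 'C(n, j) in the difference of the two expansions, where [h = k - j]. *)
pose c j := (-1) ^+ (k - j) * (a (inord (k - j)) - b (inord (k - j))).
have c0 : forall j, (j < k.+1)%N -> c j = 0.
  apply: (@binomial_sums_free _ (maxn N M)) => n; rewrite geq_max => /andP[Nn Mn].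
  have := aE n Nn; rewrite (bE n Mn) => /eqP; rewrite -subr_eq0 -sumrB => /eqP E.
  rewrite -oppr0 -[in RHS]E -sumrN (reindex_inj rev_ord_inj) /=; apply: eq_bigr => h _.
  rewrite /c subSS (_ : k - (k - h) = h)%N; last by have := ltn_ord h; lia.
  by rewrite inord_val; ring.
apply/ffunP => h; have := c0 (k - h)%N; rewrite /c ltnS leq_subr => /(_ isT).
rewrite (_ : k - (k - h) = h)%N; last by have := ltn_ord h; lia.
move/eqP; rewrite mulf_eq0 signr_eq0 /= inord_val subr_eq0 => /eqP //.
Qed.

Lemma size_le_sumn la : 0%N \notin la -> (size la <= sumn la)%N.
Proof.
elim: la => //= x la IH; rewrite inE negb_or => /andP[x0 /IH].
by move: x0; rewrite eq_sym -lt0n; lia.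
Qed.

(** The coefficients beyond [size la] are 0 because the determinant for (n - k, la) has only
    [(size la).+1] columns. *)
Lemma binomial_expansion_SYT_diag k la :
  is_partition k la ->
  binomial_expansion la
    [ffun h : 'I_k.+1 => if (h <= size la)%N then #|SYT_diag la h|%:R else 0].
Proof.
case/and3P => srt n0 /eqP sum_la; have le_size := size_le_sumn n0.
(* From this bound on, [n - k] is at least the first part of [la]. *)
exists (k + head 0 la)%N => n nk.
rewrite num_SYT_cons //; last first.
  by case: la srt {n0 sum_la le_size} nk => //= x la -> nk; rewrite andbT /=; lia.
rewrite sum_la (_ : n - k + k = n)%N; last by lia.
rewrite sum_la in le_size.
rewrite (big_ord_widen k.+1 (fun h => (-1) ^+ h * #|SYT_diag la h|%:R * 'C(n, k - h)%:R)) //.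
rewrite big_mkcond; apply: eq_bigr => h _; rewrite ffunE ltnS.
by case: ifP => // _; rewrite mulr0 mul0r.
Qed.

End Expansion.

Theorem theorem3p7 (k : nat) (la : seq nat) (Hla : is_partition k la) :
  (exists! a : {ffun 'I_k.+1 -> rat}, binomial_expansion la a) /\
  (forall a : {ffun 'I_k.+1 -> rat}, binomial_expansion la a ->
   forall h : 'I_k.+1, h <= size la ->
     [/\ a h = ((num_SYT_desc la h)%:R)%R,
         a h = (#|SYT_diag la h|%:R)%R
       & forall T : filling la, T \in SYT_diag la h ->
         forall i : nat, 0 < i <= h -> entry_col T i = 1]).
Proof.
have expand := binomial_expansion_SYT_diag Hla.
split.
  by eexists; split=> [|b]; [exact: expand | exact: binomial_expansion_inj].
move=> a /binomial_expansion_inj /(_ expand) -> h hl.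
case/and3P: Hla => srt _ /eqP sum_la.
have hn : h <= sumn la by rewrite sum_la -ltnS.
by rewrite /num_SYT_desc SYT_descE // ffunE hl; split=> // T; apply: SYT_diag_col.
Qed.
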